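(* For each $i\in\mathbb{N}^+$ and each convex body $K\subset\mathbb{R}^n$, the map $\tau_i$ (the restriction of the inverse Gauss map $\tau_K$ to $A_i$) is Lipschitz.
   Context: A convex body in $\mathbb{R}^n$ is a compact convex set with non-empty interior; $\partial K$ is its boundary and $h_K(x)=\max\{\langle x,y\rangle:y\in K\}$ is the support function. A unit vector $u$ is an outer unit normal of $K$ at $x\in\partial K$ if $\langle x,u\rangle=h_K(u)$. For $u\in S^{n-1}$, $\tau(K,\{u\})$ is the set of boundary points of $K$ having $u$ as an outer unit normal. The vector $u$ is a regular normal vector if $\tau(K,\{u\})$ consists of exactly one point; this point is denoted $\tau_K(u)$, and $\tau_K$, defined on the set of regular normal vectors, is called the inverse Gauss map. $B[x,r]$ denotes the closed ball with center $x$ and radius $r$. For $i\in\mathbb{N}^+$, $$A_i=\{u\in S^{n-1}:\exists x\in \tau(K,\{u\})\text{ such that }K\subset B[x-iu,i]\}.$$ Every $u\in A_i$ is a regular normal vector of $K$, and $\tau_i:A_i\to\partial K$ denotes the restriction of $\tau_K$ to $A_i$. *)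

(* Defs.v *)
From mathcomp Require Import all_boot all_order all_algebra.
From mathcomp Require Import interval_inference all_classical all_reals.
From mathcomp Require Import topology normedtype convex.
From mathcomp Require Import ring lra.

Set Implicit Arguments.
Unset Strict Implicit.
Unset Printing Implicit Defensive.

Import Order.TTheory GRing.Theory Num.Theory.
Import numFieldNormedType.Exports.

Local Open Scope classical_set_scope.
Local Open Scope ring_scope.

Section Euclidean.
Context {R : realType} {n : nat}.
Implicit Types (x y u v : 'rV[R]_n) (A : set 'rV[R]_n).

Definition dot x y : R := \sum_(j < n) x 0 j * y 0 j.

(* The library norm [`|x|] on row vectors is the sup norm; metric notions here
   use [enorm]. Both norms induce the same topology, so the library's
   [compact], [closure] and [interior] are the Euclidean ones. *)
Definition enorm x : R := Num.sqrt (dot x x).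

Definition unit_sphere : set 'rV[R]_n := [set u | enorm u = 1].

Definition boundary A : set 'rV[R]_n := closure A `\` interior A.

Definition lipschitz_within A (f : 'rV[R]_n -> 'rV[R]_n) : Prop :=
  exists2 L : R, 0 <= L &
    forall u v, A u -> A v -> enorm (f u - f v) <= L * enorm (u - v).

End Euclidean.

Section ConvexBodies.
Context {R : realType} {n : nat}.
Implicit Types (K : set 'rV[R]_n) (x u : 'rV[R]_n) (i : nat).

Definition convex_body K : Prop :=
  [/\ compact K, convex_set K & interior K !=set0].

(* The supremum is attained when [K] is compact and nonempty. *)
Definition support K x : R := sup [set dot x y | y in K].

Definition outer_unit_normal K x u : Prop :=
  [/\ boundary K x, unit_sphere u & dot x u = support K u].

(* tau(K, {u}) *)
Definition normal_face K u : set 'rV[R]_n := [set x | outer_unit_normal K x u].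

Definition regular_normal K : set 'rV[R]_n :=
  [set u | exists! x, normal_face K u x].

(* The inverse Gauss map tau_K; the default value 0 is only taken at vectors
   [u] with empty [normal_face K u], which are not regular. *)
Definition inverse_gauss K u : 'rV[R]_n := xget 0 (normal_face K u).

(* The set A_i. *)
Definition ball_normals K i : set 'rV[R]_n :=
  [set u | unit_sphere u /\
    exists2 x, normal_face K u x &
      K `<=` closed_ball_ enorm (x - i%:R *: u) i%:R].

Lemma enorm2 x : enorm x ^+ 2 = dot x x.
Proof. by rewrite sqr_sqrtr // sumr_ge0 // => j _; rewrite -expr2 sqr_ge0. Qed.

Lemma dot_eq0 x : dot x x = 0 -> x = 0.
Proof.
move=> /eqP; rewrite psumr_eq0 => [|j _]; last by rewrite -expr2 sqr_ge0.
move=> /allP h; apply/rowP => j; rewrite mxE; apply/eqP.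
by have := h j (mem_index_enum j); rewrite /= mulf_eq0 orbb.
Qed.

Lemma dot_shift (c : R) x y u :
  dot (x - c *: u - y) (x - c *: u - y) =
  dot (x - y) (x - y) - 2 * c * (dot x u - dot y u) + c ^+ 2 * dot u u.
Proof.
rewrite /dot mulrBr 3!mulr_sumr -!sumrB -big_split /=.
by apply: eq_bigr => j _; rewrite !mxE; ring.
Qed.

Lemma ball_normals_regular K i :
  convex_body K -> ball_normals K i `<=` regular_normal K.
Proof.
move=> [cK _ _] u [u1 [x xK Kball]]; exists x; split=> // y yK.
have Ky : K y.
  have [[clKy _] _ _] := yK; suff : closed K by apply.
  by apply: compact_closed => //; exact: norm_hausdorff.
have := Kball _ Ky; rewrite /closed_ball_ /= => yball.
have : enorm (x - i%:R *: u - y) ^+ 2 <= i%:R ^+ 2.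
  by rewrite lerXn2r ?nnegrE ?sqrtr_ge0 ?ler0n.
have uu : dot u u = 1 by rewrite -enorm2 (u1 : enorm u = 1) expr1n.
rewrite enorm2 dot_shift uu.
have -> : dot x u = dot y u by case: xK => _ _ ->; case: yK => _ _ ->.
rewrite subrr mulr0 subr0 mulr1 gerDr => xy_le0.
apply/eqP; rewrite -subr_eq0; apply/eqP/dot_eq0/eqP.
by rewrite eq_le xy_le0 sumr_ge0 // => j _; rewrite -expr2 sqr_ge0.
Qed.

Lemma inverse_gaussP K u :
  regular_normal K u -> normal_face K u = [set inverse_gauss K u].
Proof.
move=> [x [xK x_uniq]]; have gK := xgetI 0 xK.
apply/seteqP; split=> y /=; last by move=> ->.
by move=> /x_uniq <-; exact: x_uniq.
Qed.

End ConvexBodies.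

(* Main.v *)
Require Import Defs.
From mathcomp Require Import all_boot all_order all_algebra.
From mathcomp Require Import all_classical all_reals topology normedtype.
From mathcomp Require Import ring lra.

(** The inverse Gauss map is [i]-Lipschitz on [ball_normals K i].  Let [x] and
    [y] be its values at [u] and [v].  A ball of radius [i] touching [K] at [x]
    with outer normal [u] contains [K], hence [y], and this bounds the squared
    distance of [x] and [y] by [2 * i] times the depth of [y] below the
    supporting hyperplane at [x] ([dist2_le_depth]).  Adding the same bound
    with [(x, u)] and [(y, v)] exchanged turns the two depths into a single
    inner product: [dot (x - y) (x - y) <= i * dot (x - y) (u - v)].
    So the map is cocoercive, and a cocoercive map is Lipschitz
    ([cocoercive_enorm_le]). *)

Import Order.TTheory GRing.Theory Num.Theory.
Import numFieldNormedType.Exports.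

Local Open Scope classical_set_scope.
Local Open Scope ring_scope.

Section Dot.
Context {R : realType} {n : nat}.
Implicit Types (x y u v : 'rV[R]_n) (c : R).

Lemma dot_ge0 x : 0 <= dot x x.
Proof. by rewrite -enorm2 sqr_ge0. Qed.

Lemma dotBr x u v : dot x (u - v) = dot x u - dot x v.
Proof.
by rewrite /dot -sumrB; apply: eq_bigr => j _; rewrite !mxE mulrBr.
Qed.

Lemma dot_subC x y : dot (x - y) (x - y) = dot (y - x) (y - x).
Proof. by apply: eq_bigr => j _; rewrite !mxE; ring. Qed.

(** Expanding the squared distance of [y] to the centre [x - c *: u], the two
    occurrences of [c ^+ 2] cancel. *)
Lemma dist2_le_depth {c x y u} : unit_sphere u ->
  closed_ball_ enorm (x - c *: u) c y ->
  dot (x - y) (x - y) <= 2 * c * (dot x u - dot y u).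
Proof.
rewrite /closed_ball_ /= => u1 yball.
have c0 : 0 <= c := le_trans (sqrtr_ge0 _) yball.
have : enorm (x - c *: u - y) ^+ 2 <= c ^+ 2.
  by rewrite lerXn2r ?nnegrE ?sqrtr_ge0.
rewrite enorm2 dot_shift -(enorm2 u) (u1 : enorm u = 1).
lra.
Qed.

(** Since [x - y - c *: (u - v)] has nonnegative square norm, the bound assumed
    on [dot (x - y) (x - y)] is at most half of
    [dot (x - y) (x - y) + c ^+ 2 * enorm (u - v) ^+ 2]; this weak form of
    Cauchy-Schwarz loses nothing in the constant. *)
Lemma cocoercive_enorm_le c x y u v : 0 <= c ->
  dot (x - y) (x - y) <= c * (dot x (u - v) - dot y (u - v)) ->
  enorm (x - y) <= c * enorm (u - v).
Proof.
move=> c0 coco.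
have cuv0 : 0 <= c * enorm (u - v) by rewrite mulr_ge0 ?sqrtr_ge0.
rewrite -(@ler_pXn2r _ 2%N) ?nnegrE ?sqrtr_ge0 // exprMn !enorm2.
have := dot_ge0 (x - c *: (u - v) - y); rewrite dot_shift.
lra.
Qed.

End Dot.

Section InverseGauss.
Context {R : realType} {n : nat}.
Implicit Types (K : set 'rV[R]_n) (x u : 'rV[R]_n) (i : nat).

Lemma normal_face_sub {K u} : convex_body K -> normal_face K u `<=` K.
Proof.
move=> [cK _ _] x [[clKx _] _ _]; suff : closed K by apply.
by apply: compact_closed => //; exact: norm_hausdorff.
Qed.

(** Uniqueness of the normal point identifies the witness in the definition
    of [ball_normals] with the value of the inverse Gauss map. *)
Lemma ball_normals_inverse_gauss {K i u} :
  convex_body K -> ball_normals K i u ->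
  [/\ unit_sphere u, K (inverse_gauss K u) &
    K `<=` closed_ball_ enorm (inverse_gauss K u - i%:R *: u) i%:R].
Proof.
move=> Kb Au; have faceE := inverse_gaussP (ball_normals_regular Kb Au).
case: Au => u1 [x xK Kball]; have Kx := normal_face_sub Kb _ xK.
by move: xK; rewrite faceE => <-.
Qed.

End InverseGauss.

Theorem lemma5p8 (R : realType) (n : nat) (i : nat) (K : set 'rV[R]_n)
    (i_gt0 : (0 < i)%N) (K_body : convex_body K) :
  lipschitz_within (ball_normals K i) (inverse_gauss K).
Proof.
exists i%:R => // u v.
move=> /(ball_normals_inverse_gauss K_body)[u1 Kx xball].
move=> /(ball_normals_inverse_gauss K_body)[v1 Ky yball].
apply: cocoercive_enorm_le => //.
have := dist2_le_depth u1 (xball _ Ky).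
have := dist2_le_depth v1 (yball _ Kx).
rewrite dot_subC !dotBr.
lra.
Qed.
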